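(* Let $I$ be a nonempty finite set, let $(\omega_i)_{i\in I}$ be real numbers in $]0,1]$ such that $\sum_{i\in I}\omega_i=1$, and let $C$ be a nonempty closed convex subset of a real Hilbert space $\mathcal H$. For every $i\in I$, let $\mathcal G_i$ be a real Hilbert space, let $p_i\in\mathcal G_i$, let $L_i\colon\mathcal H\to\mathcal G_i$ be a nonzero bounded linear operator, and let $F_i\colon\mathcal G_i\to\mathcal G_i$ be a firmly nonexpansive operator. Let $$S_1=\{x\in C \mid (\forall i\in I)\; F_i(L_ix)=p_i\}$$ and $$S_2=\Big\{x\in C \;\Big|\; (\forall y\in C)\; \sum_{i\in I}\omega_i\langle L_i(y-x)\mid F_i(L_ix)-p_i\rangle\geq 0\Big\}.$$ Suppose that $S_1\neq\varnothing$. Then $S_1=S_2$.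
   Context: An operator $F\colon\mathcal G\to\mathcal G$ on a real Hilbert space $\mathcal G$ is firmly nonexpansive if $\langle x-y\mid Fx-Fy\rangle\geq\|Fx-Fy\|^2$ for all $x,y\in\mathcal G$. *)

(* Defs.v *)
From HB Require Import structures.
From mathcomp Require Import all_boot all_order all_algebra sesquilinear.
From mathcomp Require Import all_classical all_reals all_analysis.
Set Implicit Arguments.
Unset Strict Implicit.
Unset Printing Implicit Defensive.
Import Order.TTheory GRing.Theory Num.Theory.
Import numFieldNormedType.Exports.
Local Open Scope classical_set_scope.
Local Open Scope ring_scope.

(* A real Hilbert space is a complete normed module over R whose norm is
   induced by a scalar product. The type {dot V for idfun} bundles bilinearity,
   symmetry (theta = idfun, so there is no conjugation) and positive
   definiteness. *)
HB.mixin Record CompleteNormedModule_isHilbert (R : realType) V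
    & CompleteNormedModule R V := {
  scalp : {dot V for @idfun R} ;
  scalp_norm : forall x : V, scalp x x = `|x| ^+ 2
}.

#[short(type="hilbertType")]
HB.structure Definition Hilbert (R : realType) :=
  {V of CompleteNormedModule_isHilbert R V & CompleteNormedModule R V}.

Notation "⟨ x | y ⟩" := (scalp x y)
  (at level 0, x at level 60, y at level 60, format "⟨ x  |  y ⟩") : ring_scope.

Definition firmly_nonexpansive (R : realType) (V : hilbertType R)
    (F : V -> V) :=
  forall x y : V, ⟨ x - y | F x - F y ⟩ >= `|F x - F y| ^+ 2.

(* Main.v *)
(** Write [p i = F i (L i z)] with [z] in [S1].  Testing the variational
    inequality of [S2] at [y = z], firm nonexpansiveness bounds its left-hand
    side above by [- \sum_i w i * `|F i (L i z) - F i (L i x)| ^+ 2]; hence this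
    sum of nonnegative terms vanishes, and so does every term. *)
Require Import Defs.
From HB Require Import structures.
From mathcomp Require Import all_boot all_order all_algebra sesquilinear.
From mathcomp Require Import all_classical all_reals all_analysis.
Set Implicit Arguments.
Unset Strict Implicit.
Unset Printing Implicit Defensive.
Import Order.TTheory GRing.Theory Num.Theory.
Import numFieldNormedType.Exports.
Local Open Scope classical_set_scope.
Local Open Scope ring_scope.

Theorem proposition4p1 (R : realType) (I : finType) (hI : (0 < #|I|)%N)
    (w : I -> R) (w_itv : forall i, 0 < w i <= 1) (w_sum : \sum_(i : I) w i = 1)
    (H : hilbertType R) (C : set H)
    (C_neq0 : C !=set0) (C_closed : closed C) (C_convex : convex_set C)
    (G : I -> hilbertType R) (p : forall i, G i)
    (L : forall i, {linear H -> G i})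
    (L_bounded : forall i, bounded_near (L i) (nbhs 0))
    (L_neq0 : forall i, (L i : H -> G i) <> cst 0)
    (F : forall i, G i -> G i)
    (F_fne : forall i, firmly_nonexpansive (F i)) :
  let S1 := [set x : H | C x /\ forall i, F i (L i x) = p i] in
  let S2 := [set x : H | C x /\ forall y, C y ->
               \sum_(i : I) w i * ⟨ L i (y - x) | F i (L i x) - p i ⟩ >= 0] in
  S1 !=set0 -> S1 = S2.
Proof.
move=> S1 S2 [z [Cz Fz]]; apply/seteqP; split=> x [Cx Sx]; split=> //.
  (* At a point of [S1] each second slot [F i (L i x) - p i] is zero, so the sum vanishes
     termwise. *)
  move=> y Cy; rewrite big1// => i _.
  by rewrite Sx subrr linear0r mulr0.
have w_ge0 i : 0 <= w i by have /andP[/ltW] := w_itv i.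
have sqr_ge0 i : true -> 0 <= w i * `|F i (L i z) - F i (L i x)| ^+ 2.
  by move=> _; rewrite mulr_ge0// exprn_ge0.
have sum_eq0 : \sum_i w i * `|F i (L i z) - F i (L i x)| ^+ 2 = 0.
  apply/eqP; rewrite eq_le sumr_ge0// andbT -oppr_ge0.
  apply: le_trans (Sx z Cz) _; rewrite -sumrN; apply: ler_sum => i _.
  (* With [p i] replaced by [F i (L i z)], reversing the difference in the second slot leaves
     exactly firm nonexpansiveness at [L i z] and [L i x]. *)
  rewrite -mulrN ler_wpM2l// -(Fz i) -[F i (L i x) - _]opprB linearNr lerN2.
  by rewrite (linearB (L i)); exact: F_fne.
move=> i; move/(psumr_eq0P sqr_ge0)/(_ i isT)/eqP: sum_eq0.
(* Strict positivity of [w i] lets the weight be cancelled, so the norm itself vanishes. *)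
have /andP[/lt0r_neq0/negPf wi0 _] := w_itv i.
by rewrite mulf_eq0 wi0 sqrf_eq0 normr_eq0 subr_eq0 Fz => /eqP.
Qed.
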